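(* Let $q$ be a prime power, let $m$ and $R$ be positive integers, and let $\xi$ be a generator of $\mathbb{F}_{q^m}$ over $\mathbb{F}_q$. For $\alpha_1,\ldots,\alpha_R\in\mathbb{F}_{q^m}^*$ put $$A=\begin{pmatrix}\alpha_1^2&\alpha_2^2&\cdots&\alpha_R^2\\ \alpha_1^{q+1}&\alpha_2^{q+1}&\cdots&\alpha_R^{q+1}\\ \vdots&\vdots&&\vdots\\ \alpha_1^{q^{m-1}+1}&\alpha_2^{q^{m-1}+1}&\cdots&\alpha_R^{q^{m-1}+1}\end{pmatrix}\in\mathbb{F}_{q^m}^{m\times R},$$ and, for $i\in\{0,\ldots,m-1\}$, $b_i=(\xi^i,0,\ldots,0)^\top\in\mathbb{F}_{q^m}^m$. Let $\Sigma_i$ denote the linear system $AX=b_i$. The following are equivalent. (1) $\mu_q^{\mathrm{sym}}(m)\leq R$. (2) There exist $\alpha_1,\ldots,\alpha_R\in\mathbb{F}_{q^m}^{*}$ such that, for every $i\in\{0,\ldots,m-1\}$, the system $\Sigma_i$ admits a solution in $\mathbb{F}_q^R$. Moreover, if there exist $\alpha_1,\ldots,\alpha_R\in\mathbb{F}_{q^m}^{*}$ such that, for every $i\in\{0,\ldots,m-1\}$, the enlarged system $$\Sigma_i^*\colon\quad\begin{pmatrix} A \\ A^{[1]} \\ \vdots \\ A^{[m-1]} \end{pmatrix}X=\begin{pmatrix} b_i \\ b_i^{[1]} \\ \vdots \\ b_i^{[m-1]} \end{pmatrix}$$ admits a solution $X\in\mathbb{F}_q^R$, where $A^{[j]}$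 and $b_i^{[j]}$ denote the matrix and the vector obtained from $A$ and $b_i$ by applying the $q^j$-Frobenius $a\mapsto a^{q^j}$ entrywise, then $\mu_q^{\mathrm{sym}}(m)\leq R$.
   Context: The symmetric tensor rank $\mu_q^{\mathrm{sym}}(m)$ of the multiplication map $M_{q^m}:\mathbb{F}_{q^m}\times\mathbb{F}_{q^m}\to\mathbb{F}_{q^m}$, $(\alpha,\beta)\mapsto\alpha\beta$, is the smallest integer $R$ for which there exist $\mathbb{F}_q$-linear forms $\phi_1,\ldots,\phi_R:\mathbb{F}_{q^m}\to\mathbb{F}_q$ and elements $w_1,\ldots,w_R\in\mathbb{F}_{q^m}$ with $\alpha\beta=\sum_{i=1}^R\phi_i(\alpha)\phi_i(\beta)w_i$ for all $\alpha,\beta\in\mathbb{F}_{q^m}$. A generator of $\mathbb{F}_{q^m}$ over $\mathbb{F}_q$ is an element $\xi$ with $\mathbb{F}_{q^m}=\mathbb{F}_q(\xi)$. *)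

(* Defs.v *)
From HB Require Import structures.
From mathcomp Require Import all_boot all_order all_algebra all_field.
From mathcomp Require Import ring boolp.

Set Implicit Arguments.
Unset Strict Implicit.
Unset Printing Implicit Defensive.

Import GRing.Theory.
Local Open Scope ring_scope.

Section SymmetricTensorRank.
Variables (F : fieldType) (L : fieldExtType F).

Definition sym_decomposition (R : nat) : Prop :=
  exists (phi : 'I_R -> {scalar L}) (w : 'I_R -> L),
    forall a b : L, a * b = \sum_(i < R) (phi i a * phi i b) *: w i.

Let dec (f : L -> L -> L) : Prop :=
  exists s : seq ({scalar L} * L),
    forall a b, f a b = \sum_(p <- s) (p.1 a * p.1 b) *: p.2.

Let decD f g : dec f -> dec g -> dec (fun a b => f a b + g a b).
Proof.
by move=> [s fE] [t gE]; exists (s ++ t) => a b; rewrite big_cat /= fE gE.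
Qed.

Let dec_sum (I : Type) (r : seq I) (f : I -> L -> L -> L) :
  (forall i, dec (f i)) -> dec (fun a b => \sum_(i <- r) f i a b).
Proof.
move=> df; elim: r => [|i r IHr]; first by exists [::] => a b; rewrite !big_nil.
have [s sE] := decD (df i) IHr.
by exists s => a b; rewrite big_cons sE.
Qed.

Let dec_sq (f : {scalar L}) (w : L) : dec (fun a b => (f a * f b) *: w).
Proof. by exists [:: (f, w)] => a b; rewrite big_seq1. Qed.

Let dec_cross (f g : {scalar L}) (w : L) :
  dec (fun a b => (f a * g b + g a * f b) *: w).
Proof.
exists [:: ((f \+ g)%R : {scalar L}, w); (f, - w); (g, - w)] => a b.
rewrite !big_cons big_nil /= addr0 !scalerN -!scaleNr -!scalerDl; congr (_ *: _).
ring.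
Qed.

(* The rank-one symmetric forms span the symmetric ones over any field,
   including characteristic 2. *)
Lemma sym_decomposition_exists : exists R, `[< sym_decomposition R >].
Proof.
pose n := \dim {:L}.
pose x (i : 'I_n) : {scalar L} := coord (vbasis {:L}) i.
pose e (i : 'I_n) := (vbasis {:L})`_i.
have decs (s : seq 'I_n) : dec (fun a b =>
    (\sum_(i <- s) x i a *: e i) * (\sum_(i <- s) x i b *: e i)).
  elim: s => [|i s IHs].
    by exists [::] => a b; rewrite !big_nil mul0r.
  have [t tE] := decD (decD (dec_sq (x i) (e i * e i))
    (dec_sum s (fun j => dec_cross (x i) (x j) (e i * e j)))) IHs.
  exists t => a b; rewrite -tE !big_cons mulrDl !mulrDr !addrA.
  congr (_ + _); rewrite -addrA; congr (_ + _).
    by rewrite -scalerAl -scalerAr scalerA.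
  rewrite mulr_sumr mulr_suml -big_split /=; apply: eq_bigr => j _.
  by rewrite -!scalerAl -!scalerAr !scalerA scalerDl [e j * _]mulrC.
have [s sE] := decs (index_enum 'I_n).
exists (size s); apply/asboolP.
exists (fun i => (tnth (in_tuple s) i).1), (fun i => (tnth (in_tuple s) i).2).
move=> a b; rewrite {1}(coord_vbasis (memvf a)) {1}(coord_vbasis (memvf b)).
by rewrite sE (big_tnth _ _ s).
Qed.

Definition sym_tensor_rank : nat := ex_minn sym_decomposition_exists.

End SymmetricTensorRank.

Section Systems.
Variables (F : finFieldType) (L : fieldExtType F) (q m R : nat).

Definition system_matrix (alpha : 'I_R -> L) : 'M[L]_(m, R) :=
  \matrix_(k < m, j < R) alpha j ^+ (q ^ k + 1).

Definition system_rhs (xi : L) (i : nat) : 'cV[L]_m :=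
  \col_(k < m) (if k == 0 :> nat then xi ^+ i else 0).

Definition frobenius_mx (j n p : nat) (M : 'M[L]_(n, p)) : 'M[L]_(n, p) :=
  map_mx (fun a => a ^+ (q ^ j)) M.

Definition solvable_over_base (n : nat) (M : 'M[L]_(n, R)) (b : 'cV[L]_n) :
    Prop :=
  exists X : 'cV[F]_R, M *m map_mx (in_alg L) X = b.

Definition system_solvable (alpha : 'I_R -> L) (xi : L) (i : nat) : Prop :=
  solvable_over_base (system_matrix alpha) (system_rhs xi i).

Definition enlarged_system_solvable (alpha : 'I_R -> L) (xi : L) (i : nat) :
    Prop :=
  solvable_over_base
    (\mxcol_(j < m) frobenius_mx j (system_matrix alpha))
    (\mxcol_(j < m) frobenius_mx j (system_rhs xi i)).

End Systems.

(* Main.v *)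
Require Import Defs.
From HB Require Import structures.
From mathcomp Require Import all_boot all_order all_algebra all_field.
From mathcomp Require boolp.

Set Implicit Arguments.
Unset Strict Implicit.
Unset Printing Implicit Defensive.

Import GRing.Theory.
Local Open Scope ring_scope.

(** Write Tr for the trace of the extension L / F of finite fields, of degree m,
    with q = #|F|; it is the sum of the conjugates a ^+ (q ^ s).  Two facts
    about it carry the proof.  It takes its values in F ([ftraceE]), being fixed by the
    q-Frobenius.  The pairing (a, b) |-> Tr (a * b) is nondegenerate
    ([ftrace_nondeg]), because a q-polynomial sum_(s < m) c_s a ^+ (q ^ s) that
    vanishes for all a in L has zero coefficients ([linearized_eq0]).  Hence, for
    a basis e of L, the map a |-> (Tr (e_i a))_i is a bijection from L to F^m
    ([ftrace_basis_inj], [ftrace_basis_surj]), and every linear form on L is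
    a |-> Tr (alpha a) for some alpha.

    Take for e the powers of xi.  If phi_j is a |-> Tr (alpha_j a), the identity
    a b = sum_j phi_j(a) phi_j(b) w_j can be tested on its m coordinates
    Tr (xi^i _), so it is equivalent to
      Tr (xi^i a b) = sum_j Tr (alpha_j a) Tr (alpha_j b) x_ij     for all i,
    where x_ij = Tr (xi^i w_j); by surjectivity every array x_ij over F comes
    from some w.  The right-hand side is Tr (S_i(a) b), where
    S_i(a) = sum_j x_ij Tr (alpha_j a) alpha_j.  By nondegeneracy the i-th
    identity therefore says S_i(a) = xi^i a for all a.  Expanding the trace,
    S_i(a) is the q-polynomial whose coefficient at a ^+ (q ^ k) is
    sum_j alpha_j ^+ (q ^ k + 1) x_ij, which is the k-th row of A X.  Since
    such q-polynomials are determined by their values, the i-th identity is the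
    system A X = (xi^i, 0, ..., 0)^T ([trace_form_decompositionP]).

    Finally, a zero alpha_j can be replaced by 1 provided w_j is replaced by 0,
    and the enlarged systems contain the original ones as their first block. *)

(** * The trace pairing of an extension of finite fields *)

Section Trace.
Variables (F : finFieldType) (L : fieldExtType F).
Let q := #|F|.
Let m := \dim {:L}.
Let m_gt0 : (0 < m)%N := adim_gt0 {:L}%AS.

Lemma expf_card_iter (k : F) s : k ^+ (q ^ s) = k.
Proof. by elim: s => [|s IHs]; rewrite ?expr1 // expnS exprM expf_card. Qed.

Lemma exprD_card (a b : L) s : (a + b) ^+ (q ^ s) = a ^+ (q ^ s) + b ^+ (q ^ s).
Proof.
have [p p_pr p_char] := finPcharP F.
apply: exprDn_pchar; rewrite (eq_pnat _ (pchar_lalg L)).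
rewrite (eq_pnat _ (pcharf_eq p_char)) pnatX; apply/orP; left.
by rewrite [q](card_pprimeChar p_char) pnatX pnat_id.
Qed.

Lemma expr_card_linear s : linear (fun a : L => a ^+ (q ^ s)).
Proof. by move=> k a b; rewrite exprD_card exprZn expf_card_iter. Qed.

(** The polynomial sum_s c_s X ^ (q ^ s) has degree at most q ^ (m - 1), too
    small for it to vanish at the q ^ m elements of L unless it is zero. *)
Lemma linearized_eq0 (c : 'I_m -> L) :
  (forall a, \sum_(s < m) c s * a ^+ (q ^ s) = 0) -> forall s, c s = 0.
Proof.
move=> c0 s; have q_gt1: (1 < q)%N := finNzRing_gt1 F.
pose p : {poly L} := \sum_(s < m) c s *: 'X^(q ^ s).
have pE a : p.[a] = 0.
  rewrite -[RHS](c0 a) horner_sum; apply: eq_bigr => t _.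
  by rewrite hornerZ hornerXn.
have p0 : p = 0.
  apply/eqP; apply: contraTT (leqnn (size p)) => p_nz; rewrite -ltnNge.
  have sizeL : size (enum (finvect_type L)) = (q ^ m)%N.
    rewrite -cardE -(card_vspace (fullv : {vspace finvect_type L})).
    by apply: eq_card => a; rewrite memvf.
  apply: leq_ltn_trans (_ : q ^ m < size p)%N; last first.
    rewrite -sizeL; apply: max_poly_roots (enum_uniq _) => //.
    by apply/allP=> a _; apply/rootP/pE.
  apply: leq_trans (size_sum _ _ _) _; apply/bigmax_leqP => t _.
  by rewrite (leq_trans (size_scale_leq _ _)) // size_polyXn ltn_exp2l.
have := congr1 (fun r : {poly L} => r`_(q ^ s)) p0.
rewrite coef0 coef_sum (bigD1 s) //= coefZ coefXn eqxx mulr1 big1 ?addr0 //.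
move=> t t_s.
by rewrite coefZ coefXn eqn_exp2l // val_eqE eq_sym (negPf t_s) mulr0.
Qed.

Definition trace_sum (a : L) : L := \sum_(s < m) a ^+ (q ^ s).

Lemma trace_sum_linear : linear trace_sum.
Proof.
move=> k a b; rewrite /trace_sum scaler_sumr -big_split.
by apply: eq_bigr => s _; apply: expr_card_linear.
Qed.
HB.instance Definition _ := GRing.isLinear.Build F L L _ trace_sum
  trace_sum_linear.

(** The q-Frobenius permutes the conjugates cyclically, and its fixed points
    are the elements of F. *)
Lemma trace_sum_base a : trace_sum a \in 1%VS.
Proof.
rewrite (Fermat's_little_theorem 1%AS) dimv1 expn1 -/q.
(* The Frobenius is packed as a linear map in order to commute with the sum. *)
pose Fr (x : L) := x ^+ (q ^ 1).
pose FrD : {linear L -> L} := HB.pack Fr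
  (GRing.isLinear.Build F L L _ Fr (@expr_card_linear 1)).
rewrite -[q]expn1 -[_ ^+ _]/(FrD _) linear_sum /= /Fr /trace_sum.
under eq_bigr do rewrite -exprM -expnD addn1.
have aE : a ^+ (q ^ m) = a.
  by apply/eqP; rewrite -(Fermat's_little_theorem {:L}%AS) memvf.
rewrite -(prednK m_gt0) big_ord_recr [X in _ == X]big_ord_recl /= prednK // aE.
by rewrite expn0 expr1 addrC.
Qed.

(** The trace read in F: the coordinate of the conjugate sum on the line
    spanned by 1. *)
Definition ftrace (a : L) : F := coord [tuple (1 : L)] ord0 (trace_sum a).
HB.instance Definition _ := GRing.Linear.copy ftrace
  (coord [tuple (1 : L)] ord0 \o trace_sum).

Lemma ftraceE a : (ftrace a)%:A = trace_sum a.
Proof.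
have := @coord_span _ _ _ [tuple (1 : L)] (trace_sum a).
by rewrite span_seq1 big_ord1 => /(_ (trace_sum_base a))/esym.
Qed.

(** As a function of b, the trace of z * b is the q-polynomial with coefficients
    z ^+ (q ^ s); the one with s = 0 is z itself. *)
Lemma ftrace_nondeg z : (forall b, ftrace (z * b) = 0) -> z = 0.
Proof.
move=> z0; rewrite -[z]expr1 -(expn0 q) -[X in (_ ^ X)%N]/(val (Ordinal m_gt0)).
move: (Ordinal m_gt0); apply: (@linearized_eq0 (fun s => z ^+ (q ^ s))) => b.
rewrite -[RHS](scale0r 1) -(z0 b) ftraceE.
by apply: eq_bigr => s _; rewrite exprMn.
Qed.

Definition trace_form (alpha : L) : {scalar L} := ftrace \o (alpha \*o idfun).

Section Basis.
Variables (n : nat) (e : n.-tuple L) (eP : basis_of {:L} e).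

Lemma ftrace_basis_inj a b :
  (forall i : 'I_n, ftrace (e`_i * a) = ftrace (e`_i * b)) -> a = b.
Proof.
move=> eq_ab; apply/subr0_eq/ftrace_nondeg => c.
rewrite (coord_basis eP (memvf c)) mulr_sumr linear_sum big1 // => i _.
rewrite -scalerAr linearZ /= mulrC [(a - b) * _]mulrC mulrBr linearB /= eq_ab.
by rewrite subrr mul0r.
Qed.

(** Injectivity of a |-> (Tr (e_i a))_i and equality of the dimensions. *)
Lemma ftrace_basis_surj (v : 'I_n -> F) :
  exists a, forall i : 'I_n, ftrace (e`_i * a) = v i.
Proof.
pose T (a : L) : 'rV[F]_n := \row_i ftrace (e`_i * a).
have T_lin : linear T.
  move=> k a b; apply/rowP=> i; rewrite !mxE mulrDr linearD /= -scalerAr.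
  by rewrite linearZ.
pose f := linfun (HB.pack_for {linear L -> 'rV[F]_n} T
  (GRing.isLinear.Build F L 'rV[F]_n _ T T_lin)).
have fE a : f a = T a by rewrite lfunE.
have kf : lker f = 0%VS.
  apply/eqP/lker0P => a b; rewrite !fE => /rowP eq_ab.
  by apply: ftrace_basis_inj => i; have := eq_ab i; rewrite !mxE.
have imf : (f @: {:L} = fullv)%VS.
  apply/eqP; rewrite eqEdim subvf limg_dim_eq; last by rewrite kf capv0.
  by rewrite dimvf dim_matrix mul1r -(size_basis eP) leqnn.
have /memv_imgP[a _ aE] : \row_i v i \in (f @: {:L})%VS by rewrite imf memvf.
by exists a => i; have /rowP/(_ i) := aE; rewrite fE !mxE.
Qed.

Lemma scalar_trace_form (phi : {scalar L}) :
  exists alpha, forall a, phi a = ftrace (alpha * a).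
Proof.
have [alpha alphaE] := ftrace_basis_surj (fun i => phi e`_i).
exists alpha => a; rewrite (coord_basis eP (memvf a)) mulr_sumr !linear_sum.
apply: eq_bigr => i _.
by rewrite -scalerAr !linearZ /= -alphaE [alpha * _]mulrC.
Qed.

End Basis.

(** The step that turns bilinear identities into linear systems: both sides
    express S a = z * a for all a, with
    S a = sum_j x_j Tr (alpha_j a) alpha_j.  The left one does so by
    nondegeneracy of the trace, the right one by comparing the coefficients of
    two q-polynomials in a. *)
Lemma trace_form_decompositionP R (alpha : 'I_R -> L) (x : 'I_R -> F) z :
  (forall a b, ftrace (z * (a * b)) =
     \sum_(j < R) ftrace (alpha j * a) * ftrace (alpha j * b) * x j) <->
  (forall k : 'I_m, \sum_(j < R) alpha j ^+ (q ^ k + 1) * (x j)%:A =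
     if k == 0 :> nat then z else 0).
Proof.
pose S a : L := \sum_(j < R) (ftrace (alpha j * a) * x j) *: alpha j.
pose c (k : 'I_m) : L := \sum_(j < R) alpha j ^+ (q ^ k + 1) * (x j)%:A.
have SE a b : ftrace (S a * b) =
    \sum_(j < R) ftrace (alpha j * a) * ftrace (alpha j * b) * x j.
  rewrite mulr_suml linear_sum; apply: eq_bigr => j _.
  by rewrite -scalerAl linearZ /= mulrAC.
have ScE a : S a = \sum_(k < m) c k * a ^+ (q ^ k).
  under [RHS]eq_bigr do rewrite mulr_suml.
  rewrite exchange_big; apply: eq_bigr => j _ /=.
  rewrite [_ * x j]mulrC -scalerA -[ftrace _ *: _]mulr_algl ftraceE.
  rewrite mulr_suml scaler_sumr.
  apply: eq_bigr => k _; rewrite exprMn exprD expr1 mulr_algr -scalerAl.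
  by rewrite mulrAC.
have deltaE a :
    z * a = \sum_(k < m) (if k == 0 :> nat then z else 0) * a ^+ (q ^ k).
  rewrite (bigD1 (Ordinal m_gt0)) //= expn0 expr1 big1 ?addr0 // => k.
  by rewrite -val_eqE /= => /negPf->; rewrite mul0r.
split=> [dec k | cE a b].
  apply/subr0_eq; move: k; apply: (@linearized_eq0
    (fun k => c k - (if k == 0 :> nat then z else 0))) => a.
  under eq_bigr do rewrite mulrBl.
  rewrite sumrB -ScE -deltaE; apply: ftrace_nondeg => b.
  by rewrite mulrBl linearB /= SE -dec mulrA subrr.
rewrite -SE mulrA ScE deltaE; congr (ftrace (_ * b)).
by apply: eq_bigr => k _; rewrite -cE.
Qed.

End Trace.

(** * Decompositions of the multiplication and systems *)

Lemma power_basis (F : fieldType) (L : fieldExtType F) (xi : L) :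
  <<1; xi>>%VS = {:L}%VS -> basis_of {:L} [tuple xi ^+ i | i < \dim {:L}].
Proof.
move=> genxi; rewrite basisEdim size_tuple leqnn andbT.
have degE : adjoin_degree 1%VS xi = \dim {:L}.
  by rewrite -genxi (dim_Fadjoin 1%AS) dimv1 muln1.
rewrite -[X in (X <= _)%VS]genxi (Fadjoin_eq_sum 1%AS) /Fadjoin_sum degE.
apply/subv_sumP => i _; rewrite prod1v -memvE memv_span //.
by apply/mapP; exists i; rewrite ?mem_enum.
Qed.

(** Padding by zero forms turns a shortest decomposition into one of any
    larger length. *)
Lemma sym_tensor_rank_leP (F : fieldType) (L : fieldExtType F) R :
  (sym_tensor_rank L <= R)%N <-> sym_decomposition L R.
Proof.
rewrite /sym_tensor_rank; case: ex_minnP => r /boolp.asboolP [phi [w dec]] min_r.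
split=> [le_rR | decR]; last exact/min_r/boolp.asboolP.
rewrite -(subnKC le_rR); set d := (R - r)%N.
exists (fun j => if split j is inl i then phi i else (\0 : {scalar L})).
exists (fun j => if split j is inl i then w i else 0) => a b.
rewrite dec big_split_ord /= [X in _ + X]big1 ?addr0 => [|j _].
  by apply: eq_bigr => j _; rewrite (unsplitK (inl j)).
by rewrite (unsplitK (inr j)) scaler0.
Qed.

(** Only the direct implication has to take care of nonzero alpha: a vanishing
    form contributes nothing, so its alpha may be set to 1 once its weight w is
    set to 0. *)
Lemma sym_decomposition_systemP (F : finFieldType) (L : fieldExtType F) R
    (xi : L) : <<1; xi>>%VS = {:L}%VS ->
  sym_decomposition L R <->
  exists alpha : 'I_R -> L, (forall j, alpha j != 0) /\
    forall i : 'I_(\dim {:L}), system_solvable #|F| (\dim {:L}) alpha xi i.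
Proof.
move=> /power_basis; set e := [tuple _ | i < _] => eP.
have eE (i : 'I_(\dim {:L})) : e`_i = xi ^+ i by rewrite -tnth_nth tnth_mktuple.
(* An identity in L is tested on its coordinates Tr (xi^i _). *)
have decP phi (w : 'I_R -> L) :
  (forall a b : L, a * b = \sum_(j < R) (phi j a * phi j b) *: w j) <->
  forall (i : 'I_(\dim {:L})) (a b : L), ftrace (xi ^+ i * (a * b)) =
    \sum_(j < R) phi j a * phi j b * ftrace (xi ^+ i * w j).
  split=> [dec i a b | dec a b].
    rewrite (dec a b) mulr_sumr linear_sum; apply: eq_bigr => j _.
    by rewrite -scalerAr linearZ.
  apply: (ftrace_basis_inj eP) => i; rewrite eE dec mulr_sumr linear_sum.
  by apply: eq_bigr => j _; rewrite -scalerAr linearZ.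
split=> [[phi [w dec]] | [alpha [_ /boolp.choice[X XE]]]].
  have /boolp.choice[al0 al0E] j := scalar_trace_form eP (phi j).
  pose alpha j := if al0 j == 0 then 1 else al0 j.
  pose w' j := if al0 j == 0 then 0 else w j.
  exists alpha; split=> [j | i].
    by rewrite /alpha; case: ifPn => // _; rewrite oner_eq0.
  exists (\col_j ftrace (xi ^+ i * w' j)); apply/matrixP => k l.
  rewrite !mxE; under eq_bigr do rewrite !mxE.
  move: k; apply/trace_form_decompositionP => a b.
  move/decP: dec => ->; apply: eq_bigr => j _; rewrite !al0E /alpha /w'.
  case: ifPn => // /eqP->; rewrite mulr0 !mul0r !linear0.
  by rewrite !mul0r mulr0.
have /boolp.choice[w wE] j := ftrace_basis_surj eP (fun i => X i j 0).
exists (fun j => trace_form (alpha j)), w; apply/decP => i.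
apply/(trace_form_decompositionP alpha) => k.
have /matrixP/(_ k ord0) := XE i; rewrite !mxE => <-.
by apply: eq_bigr => j _; rewrite !mxE -eE wE.
Qed.

(** The block j = 0 is the original system, as a ^+ (q ^ 0) = a. *)
Lemma enlarged_system_solvableW (F : finFieldType) (L : fieldExtType F)
    (q m R : nat) (alpha : 'I_R -> L) (xi : L) i : (0 < m)%N ->
  enlarged_system_solvable q m alpha xi i -> system_solvable q m alpha xi i.
Proof.
move=> m_gt0 [X XE]; exists X.
have frob0 n p (M : 'M[L]_(n, p)) : frobenius_mx q 0 M = M.
  by apply/matrixP=> k l; rewrite mxE expr1.
move: XE; rewrite mxcol_mul => /(congr1 (fun M => submxcol M (Ordinal m_gt0))).
by rewrite !mxcolK !frob0.
Qed.

Theorem theorem3p2 (q m R : nat) (F : finFieldType) (L : fieldExtType F)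
    (hF : #|F| = q) (hL : \dim {:L} = m) (hm : (0 < m)%N) (hR : (0 < R)%N)
    (xi : L) (hxi : <<1; xi>>%VS = {:L}%VS) :
  ((sym_tensor_rank L <= R)%N <->
     exists alpha : 'I_R -> L,
       (forall j, alpha j != 0) /\
       forall i : 'I_m, system_solvable q m alpha xi i) /\
  ((exists alpha : 'I_R -> L,
      (forall j, alpha j != 0) /\
      forall i : 'I_m, enlarged_system_solvable q m alpha xi i) ->
   (sym_tensor_rank L <= R)%N).
Proof.
have equiv : (sym_tensor_rank L <= R)%N <->
    exists alpha : 'I_R -> L, (forall j, alpha j != 0) /\
      forall i : 'I_m, system_solvable q m alpha xi i.
  subst q m; apply: iff_trans (sym_tensor_rank_leP L R) _.
  exact: sym_decomposition_systemP.
split=> // -[alpha [alpha_nz sol]]; apply/equiv; exists alpha; split=> // i.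
exact: enlarged_system_solvableW (sol i).
Qed.
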